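(* Let $\Sigma^{(2)}$ be the set of $3$-nonnesting open permutation diagrams. To each $\sigma\in\Sigma^{(2)}$ associate the label $\ell(\sigma)=[h,r,s]$, where $2h$ is the total number of semi-arcs of $\sigma$, $r$ is the number of upper semi-arcs belonging to a future enhanced upper $2$-nesting, and $s$ is the number of lower semi-arcs belonging to a future lower $2$-nesting. Consider the generating tree with root label $[0,0,0]$ and succession rule sending $[h,r,s]$ to the labels: (1) $[h,h,s]$; (2) $[h+1,r,s]$; (3) $[h,i,s]$ for each $i$ with $\max\{0,r-1\}\le i\le h-1$; (4) $[h,r,j]$ for each $j$ with $\max\{0,s-1\}\le j\le h-1$; (5) $[h-1,i,j]$ for each pair $(i,j)$ with $\max\{0,r-1\}\le i\le h-1$ and $\max\{0,s-1\}\le j\le h-1$. Then for every $n\ge0$ the number of diagrams in $\Sigma^{(2)}$ of size $n$ equals the number of nodes at level $n$ of this tree, and the number of $3$-nonnesting permutations of size $n$ equals the number of nodes with label $[0,0,0]$ at level $n$.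
   Context: An open permutation diagram of size $n\ge0$ consists of vertices $1,\dots,n$ in a row together with upper arcs $(a,b)$, $a<b$ (drawn above), upper semi-arcs $(a,* )$ (drawn above, with a left end-point only), lower arcs $(a,b)$, $a<b$ (drawn below) and lower semi-arcs $(a,* )$ (drawn below), such that each vertex is of one of the following types: fixed point (incident to nothing); opener (left end-point of exactly one upper arc or upper semi-arc and exactly one lower arc or lower semi-arc, and nothing else); closer (right end-point of exactly one upper arc and exactly one lower arc, and nothing else); upper transitory (right end-point of one upper arc and left end-point of one upper arc or upper semi-arc, and nothing else); lower transitory (the same with lower in place of upper). The number of upper semi-arcs then equals the number of lower semi-arcs. A permutation $\sigma$ of $\{1,\dots,n\}$ is identified with the diagram without semi-arcs having an upper arc $(i,\sigma(i))$ whenever $i<\sigma(i)$ and a lower arc $(\sigma(i),i)$ whenever $\sigma(i)<i$ (vertices with $\sigma(i)=i$ are fixed points). An upper (resp. lower) $k$-nesting is a set of $k$ upper (resp. lower) arcs $(i_1,j_1),\dots,(i_k,j_k)$ with $i_1<\dots<i_k<j_k<\dots<j_1$. An upper enhanced $k$-nesting is an upper $k$-nesting, or $k-1$ upper arcs $(i_1,j_1),\dots,(i_{k-1},j_{k-1})$ and a fixed point $i_k$ with $i_1<\dots<i_{k-1}<i_k<j_{k-1}<\dots<j_1$. A future enhanced upper $k$-nesting is an upper enhanced $(k-1)$-nesting together with an upper semi-arc whose left end-point is smaller than all its vertices; a future lower $k$-nesting is a lower $(k-1)$-nesting together with a lower semi-arc whose left end-point is smaller than all its vertices. An open permutation diagram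 (or permutation) is $k$-nonnesting if it contains no upper enhanced $k$-nesting, no future enhanced upper $k$-nesting, no lower $k$-nesting and no future lower $k$-nesting. A generating tree with root label $L_0$ and a succession rule (assigning to each label a finite list of labels, with multiplicity) is the rooted tree whose root, at level $0$, has label $L_0$, and in which each node with label $L$ has one child for each entry of the list assigned to $L$, labelled by that entry; level $n$ consists of the nodes at distance $n$ from the root. *)

(* Defs.v *)
From HB Require Import structures.
From mathcomp Require Import all_boot all_fingroup.

Set Implicit Arguments.
Unset Strict Implicit.
Unset Printing Implicit Defensive.

(* The vertices 1, ..., n are represented by the ordinals 0, ..., n - 1, and
   the semi-arc (a, * ) by its left end-point a.  Sets, rather than multisets,
   of arcs suffice, as each vertex is an end-point of at most one arc or
   semi-arc in each of the four roles. *)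
Record prediagram (n : nat) := Prediagram {
  upper_arcs : {set 'I_n * 'I_n};
  upper_semi : {set 'I_n};
  lower_arcs : {set 'I_n * 'I_n};
  lower_semi : {set 'I_n}
}.

Definition prediagram_repr n (d : prediagram n) :=
  (upper_arcs d, upper_semi d, lower_arcs d, lower_semi d).

Definition prediagram_of n
    (x : {set 'I_n * 'I_n} * {set 'I_n} * {set 'I_n * 'I_n} * {set 'I_n}) :=
  let: (u, us, l, ls) := x in Prediagram u us l ls.

Lemma prediagram_reprK n : cancel (@prediagram_repr n) (@prediagram_of n).
Proof. by case. Qed.

HB.instance Definition _ n :=
  Finite.copy (prediagram n) (can_type (@prediagram_reprK n)).

Definition in_deg n (A : {set 'I_n * 'I_n}) (v : 'I_n) : nat :=
  #|[set a | (a, v) \in A]|.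

Definition out_deg n (A : {set 'I_n * 'I_n}) (S : {set 'I_n}) (v : 'I_n) : nat :=
  #|[set b | (v, b) \in A]| + (v \in S).

Definition degrees n (d : prediagram n) (v : 'I_n) : nat * nat * nat * nat :=
  (in_deg (upper_arcs d) v, out_deg (upper_arcs d) (upper_semi d) v,
   in_deg (lower_arcs d) v, out_deg (lower_arcs d) (lower_semi d) v).

Definition fixed_point n (d : prediagram n) v := degrees d v == (0, 0, 0, 0).
Definition opener n (d : prediagram n) v := degrees d v == (0, 1, 0, 1).
Definition closer n (d : prediagram n) v := degrees d v == (1, 0, 1, 0).
Definition upper_transitory n (d : prediagram n) v :=
  degrees d v == (1, 1, 0, 0).
Definition lower_transitory n (d : prediagram n) v :=
  degrees d v == (0, 0, 1, 1).

Definition open_diagram n (d : prediagram n) : bool :=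
  [&& [forall p in upper_arcs d, p.1 < p.2],
      [forall p in lower_arcs d, p.1 < p.2] &
      [forall v, [|| fixed_point d v, opener d v, closer d v,
                     upper_transitory d v | lower_transitory d v]]].

Definition perm_diagram n (s : 'S_n) : prediagram n :=
  {| upper_arcs := [set (i, s i) | i : 'I_n & i < s i];
     upper_semi := set0;
     lower_arcs := [set (s i, i) | i : 'I_n & s i < i];
     lower_semi := set0 |}.

(* For t = (i_1, j_1), ..., (i_k, j_k), this is i_1, ..., i_k, f, j_k, ..., j_1,
   where f is empty or a single fixed point. *)
Definition nesting_word n (t : seq ('I_n * 'I_n)) (f : seq 'I_n) : seq 'I_n :=
  [seq p.1 | p <- t] ++ f ++ rev [seq p.2 | p <- t].

Definition increasing n (w : seq 'I_n) : bool :=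
  sorted (fun x y : 'I_n => x < y) w.

(* In the following two definitions, P restricts the vertices of the nesting. *)
Definition has_nesting n (A : {set 'I_n * 'I_n}) (k : nat) (P : pred 'I_n) :=
  [exists t : k.-tuple ('I_n * 'I_n),
    let w := nesting_word t [::] in
    [&& all (mem A) t, increasing w & all P w]].

Definition has_enhanced_nesting n (d : prediagram n) (k : nat) (P : pred 'I_n) :=
  has_nesting (upper_arcs d) k P ||
  (0 < k) && [exists t : k.-1.-tuple ('I_n * 'I_n), [exists v : 'I_n,
    let w := nesting_word t [:: v] in
    [&& all (mem (upper_arcs d)) t, fixed_point d v, increasing w & all P w]]].

Definition future_enhanced_upper n (d : prediagram n) (k : nat) : {set 'I_n} :=
  [set a in upper_semi d | has_enhanced_nesting d k.-1 (fun v => a < v)].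

Definition future_lower n (d : prediagram n) (k : nat) : {set 'I_n} :=
  [set a in lower_semi d | has_nesting (lower_arcs d) k.-1 (fun v => a < v)].

Definition nonnesting (k : nat) n (d : prediagram n) : bool :=
  [&& ~~ has_enhanced_nesting d k predT,
      future_enhanced_upper d k == set0,
      ~~ has_nesting (lower_arcs d) k predT &
      future_lower d k == set0].

Definition Sigma2 (n : nat) : {set prediagram n} :=
  [set d | open_diagram d && nonnesting 3 d].

Definition label : Type := nat * nat * nat.

(* The label that a diagram carries as a node of the tree below.  It explains
   the succession rule, which does not itself refer to diagrams. *)
Definition diagram_label n (d : prediagram n) : label :=
  ((#|upper_semi d| + #|lower_semi d|)./2,
   #|future_enhanced_upper d 2|, #|future_lower d 2|).

(* Labels of the nodes at level m, one entry per node. *)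
Fixpoint tree_level (L : Type) (root : L) (rule : L -> seq L) (m : nat) : seq L :=
  if m is m'.+1 then flatten [seq rule x | x <- tree_level root rule m']
  else [:: root].

(* index_iota a h enumerates a <= i <= h - 1 (nothing if h = 0), and r.-1 is
   max {0, r - 1}. *)
Definition succession (x : label) : seq label :=
  let: (h, r, s) := x in
  [:: (h, h, s); (h.+1, r, s)]
  ++ [seq (h, i, s) | i <- index_iota r.-1 h]
  ++ [seq (h, r, j) | j <- index_iota s.-1 h]
  ++ [seq (h.-1, i, j) | i <- index_iota r.-1 h, j <- index_iota s.-1 h].

(* Main.v *)
Require Import Defs.
From mathcomp Require Import all_boot all_fingroup.

(* Deleting the last vertex of a 3-nonnesting diagram turns the arcs ending there
   into semi-arcs and yields a 3-nonnesting diagram again.  Conversely a child is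
   obtained by adding a fixed point, an opener, a closer or a transitory vertex,
   where in the last two cases one chooses the semi-arcs to be closed.  On the
   upper side, the semi-arcs in a future 2-nesting are the r leftmost of the h
   semi-arcs.  Closing a semi-arc puts every remaining semi-arc on its left in a
   future 2-nesting, and creates a future 3-nesting exactly when the closed
   semi-arc is among the first r without being the leftmost.  So one may close
   the leftmost one, leaving max(0, r - 1), or the (i + 1)-st for i >= r, leaving
   i.  The lower side is the same with no fixed points, hence the succession
   rule. *)

Set Implicit Arguments.
Unset Strict Implicit.
Unset Printing Implicit Defensive.

(** * Nestings in an interval *)

(* Enhanced (k + 1)-nestings with all vertices in the interval [l, u).  With
   [F] the fixed points this serves the upper arcs, with [F] empty the lower
   ones. *)
Fixpoint nest n (A : {set 'I_n * 'I_n}) (F : {set 'I_n}) (k l u : nat) : bool :=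
  if k is k'.+1 then
    [exists p in A, [&& l <= p.1, p.2 < u & nest A F k' p.1.+1 p.2]]
  else [exists p in A, [&& l <= p.1, p.1 < p.2 & p.2 < u]]
       || [exists f in F, l <= f < u].

Arguments nest : simpl never.

Lemma nest0E n (A : {set 'I_n * 'I_n}) F l u :
  nest A F 0 l u = [exists p in A, [&& l <= p.1, p.1 < p.2 & p.2 < u]]
                   || [exists f in F, l <= f < u].
Proof. by []. Qed.

Lemma nestSE n (A : {set 'I_n * 'I_n}) F k l u :
  nest A F k.+1 l u =
  [exists p in A, [&& l <= p.1, p.2 < u & nest A F k p.1.+1 p.2]].
Proof. by []. Qed.

Lemma nest_lt n (A : {set 'I_n * 'I_n}) F k l u : nest A F k l u -> l < u.
Proof.
elim: k l u => [|k IHk] l u; rewrite ?nest0E ?nestSE.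
  case/orP=> /existsP[x /andP[_]]; last by case/andP; apply: leq_ltn_trans.
  by case/and3P=> lx x12 xu; apply: leq_ltn_trans lx (ltn_trans x12 xu).
case/existsP=> p /and4P[_ lp pu /IHk pp].
by apply: leq_ltn_trans lp (ltn_trans _ pu); apply: ltn_trans pp.
Qed.

Lemma nest_leq n (A : {set 'I_n * 'I_n}) F k l l' u :
  l' <= l -> nest A F k l u -> nest A F k l' u.
Proof.
case: k => [|k] ll'; rewrite ?nest0E ?nestSE.
  case/orP=> /existsP[p]; last first.
    case/and3P=> pF lp pu; apply/orP; right; apply/existsP; exists p.
    by rewrite pF pu (leq_trans ll').
  case/and4P=> pA lp pp pu; apply/orP; left; apply/existsP; exists p.
  by rewrite pA pp pu (leq_trans ll').
case/existsP=> p /and4P[pA lp pu np]; apply/existsP; exists p.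
by rewrite pA pu np (leq_trans ll').
Qed.

Definition word_within n (l u : nat) (w : seq 'I_n) :=
  increasing w && all (fun v : 'I_n => l <= v < u) w.

(** The word of [p :: t] is that of [t] with [p.1] put in front and [p.2] at the end, so the inner
    word lies strictly between the two. This matches the recursion of [nest]. [p.1 < p.2] is listed
    separately because the inner word may be empty. *)
Lemma word_within_cons n (p : 'I_n * 'I_n) t f l u :
  word_within l u (nesting_word (p :: t) f) =
  [&& l <= p.1, p.1 < p.2, p.2 < u
    & word_within p.1.+1 p.2 (nesting_word t f)].
Proof.
have ltT : transitive (fun x y : 'I_n => x < y) by move=> ? ? ?; apply: ltn_trans.
rewrite /word_within /increasing.
have -> : nesting_word (p :: t) f = p.1 :: rcons (nesting_word t f) p.2.
  by rewrite /nesting_word /= rev_cons -!rcons_cat.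
move: (nesting_word t f) => w.
rewrite !sorted_pairwise //= pairwise_rcons !all_rcons.
apply/idP/idP.
  case/andP=> /andP[/andP[pp aw] /andP[bw ->]] /= /and3P[/andP[-> _] /andP[_ ->] _].
  rewrite pp /=; apply/allP=> x xw.
  by rewrite (allP aw) // (allP bw).
case/and5P=> lp pp pu -> aw; rewrite pp lp pu (ltn_trans pp pu) (leq_trans lp (ltnW pp)) /=.
rewrite andbT -andbA; apply/and3P; split; apply/allP=> x /(allP aw) /andP[] //.
move=> px xp; rewrite (leq_trans lp (ltnW px)); exact: ltn_trans xp pu.
Qed.

Lemma exists_tupleS (T : finType) k (Q : seq T -> bool) :
  [exists t : k.+1.-tuple T, Q t] =
  [exists x, [exists t : k.-tuple T, Q (x :: t)]].
Proof.
apply/existsP/existsP=> [[t]|[x /existsP[t Qt]]]; last by exists [tuple of x :: t].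
case/tupleP: t => x t Qt; exists x; by apply/existsP; exists t.
Qed.

Lemma exists_tuple0 (T : finType) (Q : seq T -> bool) :
  [exists t : 0.-tuple T, Q t] = Q [::].
Proof.
apply/existsP/idP=> [[t]|Q0]; last by exists [tuple].
by rewrite (tuple0 t).
Qed.

(** Links the recursive [nest] with the tuples of the definitions, by peeling off the outermost arc.
    The index is shifted by one: [k] stands for [k.+1] arcs, or for [k] arcs around a point of
    [F]. *)
Lemma nestE n (A : {set 'I_n * 'I_n}) (F : {set 'I_n}) k l u :
  nest A F k l u =
  [exists t : k.+1.-tuple ('I_n * 'I_n),
     all (mem A) t && word_within l u (nesting_word t [::])]
  || [exists t : k.-tuple ('I_n * 'I_n), [exists v in F,
     all (mem A) t && word_within l u (nesting_word t [:: v])]].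
Proof.
pose Q l u (t : seq ('I_n * 'I_n)) (f : seq 'I_n) :=
  all (mem A) t && word_within l u (nesting_word t f).
have Q_cons m v p t f :
    Q m v (p :: t) f = [&& p \in A, m <= p.1, p.1 < p.2, p.2 < v & Q p.1.+1 p.2 t f].
  by rewrite /Q word_within_cons /=; case: (p \in A); case: (all _ t); rewrite /= ?andbF.
pose Q1 m v t := Q m v t [::].
pose Q2 m v t := [exists f in F, Q m v t [:: f]].
rewrite -[RHS]/([exists t : k.+1.-tuple _, Q1 l u t] || [exists t : k.-tuple _, Q2 l u t]).
elim: k l u => [|k IHk] l u.
  rewrite nest0E (exists_tupleS 0 (Q1 l u)) (exists_tuple0 (Q2 l u)).
  congr (_ || _); apply: eq_existsb => p; last first.
    by rewrite /Q /word_within /= !andbT.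
  by rewrite (exists_tuple0 (fun t => Q1 l u (p :: t))) /Q1 Q_cons andbT.
rewrite nestSE (exists_tupleS k.+1 (Q1 l u)) (exists_tupleS k (Q2 l u)).
apply/existsP/orP.
  (* The recursive case of [nest] does not state [p.1 < p.2]; it follows because the inner interval
     is nonempty. *)
  case=> p /and4P[pA lp pu np]; have pp := ltn_trans (ltnSn _) (nest_lt np).
  move: np; rewrite IHk; case/orP=> /existsP[t tQ].
    left; apply/existsP; exists p; apply/existsP; exists t.
    by rewrite /Q1 Q_cons pA lp pp pu.
  case/existsP: tQ => f /andP[fF tQ].
  right; apply/existsP; exists p; apply/existsP; exists t; apply/existsP; exists f.
  by rewrite fF Q_cons pA lp pp pu.
case=> /existsP[p /existsP[t]].
  rewrite /Q1 Q_cons => /and5P[pA lp pp pu tQ].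
  by exists p; rewrite pA lp pu IHk; apply/orP; left; apply/existsP; exists t.
case/existsP=> f; rewrite Q_cons => /and5P[fF pA lp pp /andP[pu tQ]].
exists p; rewrite pA lp pu IHk; apply/orP; right; apply/existsP; exists t.
by apply/existsP; exists f; rewrite fF.
Qed.

Definition fixed_points n (d : prediagram n) := [set v | fixed_point d v].

(** It serves [predT] with [l = 0] and the vertices to the right of [a] with [l = a.+1]. The upper
    bound [n] holds for every vertex. *)
Lemma has_nestingE n (A : {set 'I_n * 'I_n}) k l (P : pred 'I_n) :
  (forall v, P v = (l <= v)) -> has_nesting A k.+1 P = nest A set0 k l n.
Proof.
move=> PE; rewrite nestE orbC.
case: existsP => [[t /existsP[v]]|_ /=]; first by rewrite inE.
apply: eq_existsb => t; congr (_ && (_ && _)).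
by apply: eq_all => v; rewrite PE ltn_ord andbT.
Qed.

Lemma has_enhanced_nestingE n (d : prediagram n) k (l : nat) (P : pred 'I_n) :
  (forall v, P v = (l <= v)) ->
  has_enhanced_nesting d k.+1 P = nest (upper_arcs d) (fixed_points d) k l n.
Proof.
move=> PE; rewrite nestE /has_enhanced_nesting /has_nesting /=.
have allE (w : seq 'I_n) : all P w = all (fun v : 'I_n => l <= v < n) w.
  by apply: eq_all => v; rewrite PE ltn_ord andbT.
congr (_ || _); apply: eq_existsb => t; first by rewrite allE.
apply: eq_existsb => v; rewrite allE inE /word_within.
by case: (all _ _); case: (fixed_point d v); rewrite ?andbF.
Qed.

(** One side of [nonnesting 3]. By the index shift in [nest], index 2 means a 3-nesting, and index 1
    to the right of a semi-arc [a] means a future 3-nesting. *)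
Definition half_nonnesting n (A : {set 'I_n * 'I_n}) (S F : {set 'I_n}) :=
  ~~ nest A F 2 0 n && [forall a in S, ~~ nest A F 1 a.+1 n].

(* The semi-arcs in a future 2-nesting; their number is the r or s of the label. *)
Definition covering n (A : {set 'I_n * 'I_n}) (S F : {set 'I_n}) : {set 'I_n} :=
  [set a in S | nest A F 0 a.+1 n].

Lemma set_filter_eq0 (T : finType) (S : {set T}) (P : pred T) :
  ([set a in S | P a] == set0) = [forall a in S, ~~ P a].
Proof.
apply/eqP/'forall_implyP=> [S0 a aS|PS].
  by apply/negP=> Pa; have := in_set0 a; rewrite -S0 inE aS Pa.
by apply/setP=> a; rewrite !inE; apply/andP=> [[/PS /negP]].
Qed.

Lemma nonnestingE n (d : prediagram n) :
  nonnesting 3 d =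
  half_nonnesting (upper_arcs d) (upper_semi d) (fixed_points d)
  && half_nonnesting (lower_arcs d) (lower_semi d) set0.
Proof.
rewrite /nonnesting (has_enhanced_nestingE d _ (l := 0)) // (has_nestingE _ 2 (l := 0)) //.
rewrite !set_filter_eq0 /half_nonnesting -!andbA; congr [&& _, _, _ & _].
  by apply: eq_forallb => a; rewrite (has_enhanced_nestingE d _ (l := a.+1)).
by apply: eq_forallb => a; rewrite (has_nestingE _ _ (l := a.+1)).
Qed.

Lemma diagram_labelE n (d : prediagram n) :
  diagram_label d =
  ((#|upper_semi d| + #|lower_semi d|)./2,
   #|covering (upper_arcs d) (upper_semi d) (fixed_points d)|,
   #|covering (lower_arcs d) (lower_semi d) set0|).
Proof.
congr (_, _, _); apply: eq_card => a; rewrite !inE.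
  by rewrite (has_enhanced_nestingE d _ (l := a.+1)).
by rewrite (has_nestingE _ _ (l := a.+1)).
Qed.

(** * Adding a last vertex to one side of a diagram *)

Notation up := (lift ord_max).

Variant max_or_up n : 'I_n.+1 -> Type :=
  | LastMax : max_or_up ord_max
  | LastUp i : max_or_up (up i).

Lemma max_or_upP n (v : 'I_n.+1) : max_or_up v.
Proof. by case: (unliftP ord_max v) => [i|] ->; constructor. Qed.

Lemma up_lt_max n (i : 'I_n) : up i < (ord_max : 'I_n.+1).
Proof. by rewrite lift_max ltn_ord. Qed.

Lemma card_last n (P : pred 'I_n.+1) :
  #|[set v | P v]| = P ord_max + #|[set i | P (up i)]|.
Proof.
rewrite !cardsE -!sum1_card big_mkcond (bigD1_ord ord_max) //= -big_mkcond /=.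
by congr (_ + _); rewrite unfold_in; case: (P _).
Qed.

Lemma exists_last n (P : pred 'I_n.+1) :
  [exists v, P v] = P ord_max || [exists i, P (up i)].
Proof.
apply/existsP/orP=> [[v]|[Pm|/existsP[i Pi]]].
- by case: (max_or_upP v) => [|i] Pv; [left | right; apply/existsP; exists i].
- by exists ord_max.
- by exists (up i).
Qed.

Notation "o '\isub' S" := ((if o is Some x then x \in S else true) : bool)
  (at level 70, no associativity).

Definition ext_set n (S : {set 'I_n}) (b : bool) : {set 'I_n.+1} :=
  [set v | if unlift ord_max v is Some i then i \in S else b].

(** The new vertex is [ord_max]. The semi-arc [o], if any, is completed to an arc ending there;
    being last, the new vertex starts no arc. *)
Definition ext_arcs n (A : {set 'I_n * 'I_n}) (o : option 'I_n) :
    {set 'I_n.+1 * 'I_n.+1} :=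
  [set p | match unlift ord_max p.1, unlift ord_max p.2 with
           | Some i, Some j => (i, j) \in A
           | Some i, None => o == Some i
           | None, _ => false
           end].

Definition ext_semi n (S : {set 'I_n}) o b : {set 'I_n.+1} :=
  ext_set [set v in S | o != Some v] b.

Lemma ext_setE n (S : {set 'I_n}) b :
  (ord_max \in ext_set S b = b) * (forall i, (up i \in ext_set S b) = (i \in S)).
Proof. by split=> [|i]; rewrite inE ?unlift_none ?liftK. Qed.

Lemma ext_set0 n : ext_set (set0 : {set 'I_n}) false = set0.
Proof. by apply/setP=> v; case: (max_or_upP v) => [|i]; rewrite ext_setE !inE. Qed.

Lemma ext_arcsE n (A : {set 'I_n * 'I_n}) o :
  (forall i j, ((up i, up j) \in ext_arcs A o) = ((i, j) \in A))
  * (forall i, ((up i, ord_max) \in ext_arcs A o) = (o == Some i))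
  * (forall v, ((ord_max, v) \in ext_arcs A o) = false).
Proof. by do !split=> *; rewrite inE /= ?unlift_none ?liftK. Qed.

Lemma ext_semiE n (S : {set 'I_n}) o b :
  (ord_max \in ext_semi S o b = b) *
  (forall i, (up i \in ext_semi S o b) = (i \in S) && (o != Some i)).
Proof. by split=> [|i]; rewrite ext_setE // inE. Qed.

(** [Q] is a relation on numbers so that it applies to the vertices of both sizes: [up] preserves
    the value, and the new vertex has value [n]. *)
Lemma exists_ext_arcs n (A : {set 'I_n * 'I_n}) o (Q : nat -> nat -> bool) :
  [exists p in ext_arcs A o, Q p.1 p.2] =
  [exists p in A, Q p.1 p.2] || (if o is Some x then Q x n else false).
Proof.
apply/existsP/orP=> [[[v w]]|[/existsP[[i j]]|]].
- case: (max_or_upP v) => [|i]; first by rewrite ext_arcsE.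
  case: (max_or_upP w) => [|j]; rewrite ext_arcsE !lift_max.
    by case/andP=> /eqP->; right.
  by left; apply/existsP; exists (i, j).
- by move=> ijA; exists (up i, up j); rewrite ext_arcsE !lift_max.
- by case: o => // x Qx; exists (up x, ord_max); rewrite ext_arcsE lift_max eqxx.
Qed.

(** The bound [u <= n] keeps out the new vertex, and with it both the new arc and a new fixed
    point. *)
Lemma nest_ext_below n (A : {set 'I_n * 'I_n}) F o f k l u :
  u <= n -> nest (ext_arcs A o) (ext_set F f) k l u = nest A F k l u.
Proof.
elim: k l u => [|k IHk] l u un.
  rewrite !nest0E (exists_ext_arcs A o (fun i j => [&& l <= i, i < j & j < u])) exists_last.
  rewrite ext_setE [ord_max < u]ltnNge un !andbF orFb.
  have -> : (if o is Some x then [&& l <= x, x < n & false] else false) = false.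
    by case: o => // x; rewrite !andbF.
  rewrite orbF; congr (_ || _); apply: eq_existsb => i.
  by rewrite ext_setE lift_max.
rewrite !nestSE.
pose Q i j := [&& l <= i, j < u & nest (ext_arcs A o) (ext_set F f) k i.+1 j].
rewrite -[LHS]/[exists p in ext_arcs A o, Q p.1 p.2] (exists_ext_arcs A o Q).
have -> : (if o is Some x then Q x n else false) = false.
  by rewrite /Q; case: (o) => // x; rewrite [n < u]ltnNge un andbF.
rewrite orbF; apply: eq_existsb => p; rewrite /Q.
by rewrite IHk // ltnW.
Qed.

Lemma nest0_ext n (A : {set 'I_n * 'I_n}) F o f l : l <= n ->
  nest (ext_arcs A o) (ext_set F f) 0 l n.+1 =
  [|| nest A F 0 l n, f | if o is Some x then l <= x else false].
Proof.
move=> ln; rewrite !nest0E exists_last ext_setE ln leqnn andbT.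
rewrite (exists_ext_arcs A o (fun i j => [&& l <= i, i < j & j < n.+1])).
rewrite -!orbA; congr (_ || _).
  by apply: eq_existsb => p; rewrite !ltn_ord ltnS (ltnW (ltn_ord _)).
have -> : (if o is Some x then [&& l <= x, x < n & n < n.+1] else false) =
          (if o is Some x then l <= x else false).
  by case: o => // x; rewrite ltn_ord leqnn !andbT.
rewrite orbCA [RHS]orbCA; congr (f || _); rewrite orbC; congr (_ || _).
apply: eq_existsb => i.
by rewrite ext_setE lift_max ltn_ord ltnS (ltnW (ltn_ord _)).
Qed.

(** The last vertex can only be the right end of the outermost arc. A new nesting is therefore the
    arc from [x] around an old nesting with one element less; a new fixed point lies under no
    arc. *)
Lemma nestS_ext n (A : {set 'I_n * 'I_n}) F o f k l :
  nest (ext_arcs A o) (ext_set F f) k.+1 l n.+1 =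
  nest A F k.+1 l n || (if o is Some x then (l <= x) && nest A F k x.+1 n else false).
Proof.
rewrite !nestSE.
pose Q i j := [&& l <= i, j < n.+1 & nest (ext_arcs A o) (ext_set F f) k i.+1 j].
rewrite -[LHS]/[exists p in ext_arcs A o, Q p.1 p.2] (exists_ext_arcs A o Q).
congr (_ || _); last first.
  by case: o @Q => // x Q; rewrite /Q leqnn nest_ext_below.
apply: eq_existsb => p; rewrite /Q nest_ext_below ?(ltnW (ltn_ord _)) //.
by rewrite ltn_ord ltnS (ltnW (ltn_ord _)).
Qed.

Definition rank n (S : {set 'I_n}) (x : nat) := #|[set a in S | a < x]|.

(* The semi-arcs that can be closed without creating a future 3-nesting. *)
Definition closable n (A : {set 'I_n * 'I_n}) (S F : {set 'I_n}) (x : 'I_n) :=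
  (x \notin covering A S F) || (rank S x == 0).

Lemma rank_eq0 n (S : {set 'I_n}) x : (rank S x == 0) = [forall a in S, x <= a].
Proof.
rewrite cards_eq0 set_filter_eq0; apply: eq_forallb => a.
by rewrite -leqNgt.
Qed.

(** The arc from [x] completes a 3-nesting only if the semi-arc [x] was already in a future
    3-nesting. It completes a future 3-nesting with each semi-arc on its left as soon as [x] is
    covering, and [closable] says that this does not occur. *)
Lemma half_nonnesting_ext n (A : {set 'I_n * 'I_n}) (S F : {set 'I_n}) o b f :
  o \isub S ->
  half_nonnesting (ext_arcs A o) (ext_semi S o b) (ext_set F f) =
  half_nonnesting A S F && (if o is Some x then closable A S F x else true).
Proof.
move=> oS; rewrite /half_nonnesting nestS_ext.
have -> : [forall a in ext_semi S o b,
             ~~ nest (ext_arcs A o) (ext_set F f) 1 a.+1 n.+1] =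
          [forall a in S, (o == Some a) ||
             ~~ nest A F 1 a.+1 n
             && (if o is Some x then ~~ ((a < x) && nest A F 0 x.+1 n) else true)].
  apply/'forall_implyP/'forall_implyP=> H => [a aS|v].
    have := H (up a); rewrite ext_semiE aS lift_max nestS_ext /= .
    case: eqP => // _ /(_ isT); rewrite negb_or => /andP[-> ].
    by case: (o).
  (* A semi-arc starting at the last vertex has nothing on its right. *)
  case: (max_or_upP v) => [|a].
    by move=> _; apply/negP=> /nest_lt; rewrite ltnn.
  rewrite ext_semiE lift_max nestS_ext => /andP[/H]; case: eqP => //= _.
  by case/andP=> nn; rewrite negb_or nn; case: (o).
case: o oS => [x|_]; last first.
  by rewrite /= orbF andbT; congr (_ && _); apply: eq_forallb => a; rewrite andbT.
(* After closing, [x] is exempt from the condition on semi-arcs, but the absence of a 3-nesting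
   around the new arc is that same condition for [x]. *)
move=> xS; rewrite leq0n negb_or -!andbA; congr (_ && _).
rewrite /closable inE xS rank_eq0 /=.
case xN: (nest A F 0 x.+1 n) => /=; last first.
  rewrite andbT; apply/andP/'forall_implyP=> [[xN1 /'forall_implyP H] a aS|H].
    have := H a aS; rewrite andbF andbT; case: eqP => // [[<-]] //.
  by split; [exact: H | apply/'forall_implyP=> a aS; rewrite H // andbF orbT].
apply/andP/andP=> [] [].
  move=> xN1 /'forall_implyP H; split; apply/'forall_implyP=> a aS;
    have := H a aS; rewrite andbT -leqNgt; case: eqP => [[<-] _ //|_ /andP[//]].
move=> /'forall_implyP H /'forall_implyP H'; split; first exact: H.
by apply/'forall_implyP=> a aS; rewrite H // ltnNge H' // orbT.
Qed.

Lemma card_set_last n (T : {set 'I_n.+1}) :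
  #|T| = (ord_max \in T) + #|[set i | up i \in T]|.
Proof. by rewrite -cardsE card_last. Qed.

(** The additive form avoids truncated subtraction; [o] is coerced to 0 or 1. *)
Lemma card_ext_semi n (S : {set 'I_n}) o b :
  o \isub S ->
  #|ext_semi S o b| + o = #|S| + b.
Proof.
move=> oS; rewrite card_set_last ext_semiE -addnA addnC; congr (_ + _).
case: o oS => [x|_] /=; last first.
  by rewrite addn0; apply: eq_card => i; rewrite [LHS]in_set ext_semiE andbT.
move=> xS; rewrite (cardsD1 x S) xS addnC; congr (_ + _); apply: eq_card => i.
by rewrite [LHS]in_set ext_semiE in_setD1 andbC [Some x == _](inj_eq Some_inj) eq_sym.
Qed.

(** An old semi-arc is in a future 2-nesting if it was before, if the new vertex is a fixed point,
    or if the closed semi-arc starts on its right. A semi-arc at the new vertex is in none. *)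
Lemma card_covering_ext n (A : {set 'I_n * 'I_n}) (S F : {set 'I_n}) o b f :
  #|covering (ext_arcs A o) (ext_semi S o b) (ext_set F f)| =
  #|[set a in S | (o != Some a) &&
      [|| nest A F 0 a.+1 n, f | if o is Some x then a < x else false]]|.
Proof.
rewrite card_set_last inE [X in _ && X](_ : _ = false) ?andbF; last first.
  by apply/negP=> /nest_lt; rewrite ltnn.
apply: eq_card => a; rewrite [LHS]in_set inE [RHS]in_set ext_semiE lift_max -andbA; congr [&& _, _ & _].
by rewrite nest0_ext.
Qed.

(** * Ranks of semi-arcs from the left, and the effect of closing one *)

Section Rank.

Variables (n : nat) (A : {set 'I_n * 'I_n}) (S F : {set 'I_n}).

Local Notation cov := (covering A S F).

Lemma covering_sub : cov \subset S.
Proof. by apply/subsetP=> a; rewrite inE => /andP[]. Qed.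

Lemma covering_down (a x : 'I_n) : a \in S -> a < x -> x \in cov -> a \in cov.
Proof. by move=> aS ax; rewrite !inE aS => /andP[_]; apply: nest_leq; apply: ltnW. Qed.

(** By [covering_down] the covering semi-arcs form an initial segment of [S], so their number is the
    threshold for the rank. *)
Lemma covering_rank (x : 'I_n) : x \in S -> (x \in cov) = (rank S x < #|cov|).
Proof.
move=> xS; apply/idP/idP=> [xc|].
  apply: proper_card; apply/properP; split.
    apply/subsetP=> a; rewrite inE => /andP[aS ax]; exact: covering_down ax xc.
  by exists x => //; rewrite inE ltnn andbF.
apply: contraTT => xc; rewrite -leqNgt; apply: subset_leq_card.
apply/subsetP=> a ac; have aS := subsetP covering_sub a ac.
rewrite inE aS ltnNge; apply: contra xc; rewrite leq_eqVlt.
case/orP=> [/eqP/val_inj->|xa] //; exact: covering_down xa ac.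
Qed.

(** If [x] is covering, then it is the leftmost semi-arc, so the new arc affects no other one and
    only [x] itself is lost. Otherwise all covering semi-arcs lie to the left of [x], and after
    closing the covering ones are exactly those on its left. *)
Lemma card_covering_close b x : x \in S -> closable A S F x ->
  #|covering (ext_arcs A (Some x)) (ext_semi S (Some x) b) (ext_set F false)| =
  if rank S x < #|cov| then #|cov|.-1 else rank S x.
Proof.
move=> xS; rewrite card_covering_ext -covering_rank // /closable rank_eq0.
have [xc /'forall_implyP minx|xc _] := boolP (x \in cov).
  rewrite (cardsD1 x cov) xc; apply: eq_card => a; rewrite !inE /=.
  rewrite [Some x == _](inj_eq Some_inj) eq_sym.
  case aS: (a \in S); rewrite ?andbF //= ltnNge minx //= orbF.
  by [].
apply: eq_card => a; rewrite !inE /= (inj_eq Some_inj).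
have [aS|//] := boolP (a \in S); have [->|xa] /= := eqVneq x a; first by rewrite ltnn.
apply/orP/idP=> [[na|]|] //; last by right.
rewrite ltn_neqAle eq_sym xa leqNgt; apply: contra xc => xa'.
by apply: covering_down xa' _ => //; rewrite inE aS.
Qed.

Lemma rank_inj : {in S &, injective (fun x : 'I_n => rank S x)}.
Proof.
move=> x y xS yS.
wlog xy : x y xS yS / x <= y => [H|].
  by case/orP: (leq_total x y) => ? ?; [|apply/esym]; apply: H.
move: xy; rewrite leq_eqVlt => /orP[/eqP/val_inj//|xy].
have /proper_card : [set a in S | a < x] \proper [set a in S | a < y].
  apply/properP; split; last by exists x; rewrite !inE ?xS ?ltnn.
  by apply/subsetP=> a; rewrite !inE => /andP[-> /ltn_trans->].
by rewrite -/(rank S x) -/(rank S y) => lt_r eq_r; rewrite eq_r ltnn in lt_r.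
Qed.

(** The ranks are distinct and less than [#|S|], so by counting they exhaust these values. *)
Lemma perm_rank : perm_eq [seq rank S (x : 'I_n) | x <- enum S] (iota 0 #|S|).
Proof.
have ur : uniq [seq rank S (x : 'I_n) | x <- enum S].
  rewrite map_inj_in_uniq ?enum_uniq // => x y; rewrite !mem_enum; exact: rank_inj.
apply: uniq_perm; rewrite ?iota_uniq //.
have [||//] := uniq_min_size ur (s2 := iota 0 #|S|).
  move=> _ /mapP[x + ->]; rewrite mem_enum => xS; rewrite mem_iota add0n /=.
  apply: proper_card; apply/properP; split; last by exists x; rewrite // inE ltnn andbF.
  by apply/subsetP=> a; rewrite inE => /andP[].
by rewrite size_iota size_map -cardE.
Qed.

Definition closable_semis := [seq x <- enum S | closable A S F x].

(** In terms of ranks, with [c] covering semi-arcs, one may close rank 0 and the ranks from [c] on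
    ([ok]). The results ([g]) are [c.-1] for rank 0 when [c > 0], and [k] for each rank [k >= c]. *)
Lemma perm_closable b :
  perm_eq
    [seq #|covering (ext_arcs A (Some x)) (ext_semi S (Some x) b) (ext_set F false)|
      | x <- closable_semis]
    (index_iota #|cov|.-1 #|S|).
Proof.
set c := #|cov|; have cS : c <= #|S| by apply: subset_leq_card covering_sub.
pose ok k := (c <= k) || (k == 0); pose g k := if k < c then c.-1 else k.
rewrite (_ : map _ _ = map g (filter ok [seq rank S (x : 'I_n) | x <- enum S])).
  apply: perm_trans (perm_map g (perm_filter ok perm_rank)) _.
  rewrite -(subnKC cS) iotaD filter_cat map_cat.
  have -> : [seq g i | i <- [seq i <- iota (0 + c) (#|S| - c) | ok i]] = index_iota c #|S|.
    rewrite add0n (eq_in_filter (a2 := predT)) ?filter_predT.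
      rewrite -[RHS]map_id; apply/eq_in_map=> i; rewrite mem_iota => /andP[ci _].
      by rewrite /g ltnNge ci.
    by move=> i; rewrite mem_iota /ok => /andP[->].
  (* For [c = 0] there are no ranks below [c]. Otherwise only rank 0 passes the filter among them,
     and it supplies the entry [c.-1] in front. *)
  rewrite subnKC //; case: c @ok @g cS => [|c] ok g cS //=.
  rewrite (eq_in_filter (a2 := pred0)) ?filter_pred0 /=; last first.
    by move=> i; rewrite mem_iota /ok add1n => /andP[i0 ic]; rewrite ltnNge -ltnS ic; case: i i0 {ic}.
  by rewrite /g /= /index_iota -[X in _ (iota _ X)](subnSK cS).
rewrite filter_map -map_comp /closable_semis.
have eq_ok : {in enum S, closable A S F =1 (fun x : 'I_n => ok (rank S x))}.
  by move=> x; rewrite mem_enum => xS; rewrite /closable covering_rank // -leqNgt.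
rewrite -(eq_in_filter eq_ok); apply/eq_in_map=> x.
by rewrite mem_filter mem_enum => /andP[cx xS]; apply: card_covering_close.
Qed.

End Rank.

(** * Adding a last vertex to a diagram *)

Lemma in_deg_ext_up n (A : {set 'I_n * 'I_n}) o v :
  in_deg (ext_arcs A o) (up v) = in_deg A v.
Proof.
rewrite /in_deg card_last ext_arcsE; apply: eq_card => a.
by rewrite [LHS]in_set [RHS]in_set ext_arcsE.
Qed.

Lemma in_deg_ext_max n (A : {set 'I_n * 'I_n}) o :
  in_deg (ext_arcs A o) ord_max = o.
Proof.
rewrite /in_deg card_last ext_arcsE.
case: o => [x|]; last first.
  by apply: eq_card0 => a; rewrite [LHS]in_set ext_arcsE.
rewrite -[RHS](cards1 x); apply: eq_card => a.
by rewrite [LHS]in_set ext_arcsE in_set1 [Some x == _](inj_eq Some_inj) eq_sym.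
Qed.

(** Closing a semi-arc replaces it by an arc with the same left end-point. *)
Lemma out_deg_ext_up n (A : {set 'I_n * 'I_n}) (S : {set 'I_n}) o b v : o \isub S ->
  out_deg (ext_arcs A o) (ext_semi S o b) (up v) = out_deg A S v.
Proof.
move=> oS; rewrite /out_deg card_last ext_arcsE ext_semiE addnAC addnC; congr (_ + _).
  by apply: eq_card => a; rewrite [LHS]in_set [RHS]in_set ext_arcsE.
by case: eqP oS => [->->|_ _]; rewrite ?andbF ?andbT.
Qed.

Lemma out_deg_ext_max n (A : {set 'I_n * 'I_n}) (S : {set 'I_n}) o b :
  out_deg (ext_arcs A o) (ext_semi S o b) ord_max = b.
Proof.
rewrite /out_deg card_last ext_arcsE ext_semiE eq_card0 // => a.
by rewrite [LHS]in_set ext_arcsE.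
Qed.

Lemma ltn_ext_arcs n (A : {set 'I_n * 'I_n}) o :
  [forall p in ext_arcs A o, p.1 < p.2] = [forall p in A, p.1 < p.2].
Proof.
apply/'forall_implyP/'forall_implyP=> lt_A [i j] /=.
  move=> ijA; rewrite -[nat_of_ord i]lift_max -[nat_of_ord j]lift_max.
  by apply: (lt_A (up i, up j)); rewrite ext_arcsE.
case: (max_or_upP i) => [|{}i]; first by rewrite ext_arcsE.
case: (max_or_upP j) => [_|{}j]; first exact: up_lt_max.
by rewrite ext_arcsE => /lt_A; rewrite !lift_max.
Qed.

(** * Deleting the last vertex *)

Definition res_arcs n (A : {set 'I_n.+1 * 'I_n.+1}) : {set 'I_n * 'I_n} :=
  [set p | (up p.1, up p.2) \in A].

Definition res_semi n (A : {set 'I_n.+1 * 'I_n.+1}) (S : {set 'I_n.+1}) : {set 'I_n} :=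
  [set v | (up v \in S) || ((up v, ord_max) \in A)].

Lemma ext_arcsK n (A : {set 'I_n * 'I_n}) o : res_arcs (ext_arcs A o) = A.
Proof. by apply/setP=> [[i j]]; rewrite [LHS]in_set ext_arcsE. Qed.

Lemma ext_semiK n (A : {set 'I_n * 'I_n}) (S : {set 'I_n}) o b : o \isub S ->
  res_semi (ext_arcs A o) (ext_semi S o b) = S.
Proof.
move=> oS; apply/setP=> v; rewrite [LHS]in_set ext_arcsE ext_semiE.
by case: eqP oS => [->->|_ _]; rewrite ?andbF ?andbT ?orbF.
Qed.

(** The in-degree bound makes the arc ending at the last vertex unique, which gives [o]. The
    out-degree bound prevents a vertex from having both that arc and a semi-arc; [ext_semi] would
    lose the latter. *)
Lemma ext_res n (A : {set 'I_n.+1 * 'I_n.+1}) (S : {set 'I_n.+1}) :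
  [forall p in A, p.1 < p.2] -> in_deg A ord_max <= 1 ->
  (forall v, out_deg A S v <= 1) ->
  exists o, [/\ o \isub res_semi A S, ext_arcs (res_arcs A) o = A
    & ext_semi (res_semi A S) o (ord_max \in S) = S].
Proof.
move=> /'forall_implyP lt_A in1 out1.
pose o := [pick x : 'I_n | (up x, ord_max) \in A].
have oE x : (o == Some x) = ((up x, ord_max) \in A).
  rewrite /o; case: pickP => [y yA|->//]; rewrite (inj_eq Some_inj).
  apply/eqP/idP=> [<- //|xA].
  move/card_le1_eqP: in1 => /(_ (up y) (up x)); rewrite !inE yA xA.
  by move=> /(_ isT isT)/lift_inj.
have maxA v : ((ord_max, v) \in A) = false.
  by apply/negP=> /lt_A /=; rewrite ltnNge -ltnS ltn_ord.
exists o; split.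
- by rewrite /o; case: pickP => // x xA; rewrite inE xA orbT.
- apply/setP=> [[i j]]; case: (max_or_upP i) => [|{}i]; first by rewrite ext_arcsE maxA.
  by case: (max_or_upP j) => [|{}j]; rewrite ext_arcsE ?oE // [LHS]in_set.
apply/setP=> v; case: (max_or_upP v) => [|{}v]; rewrite ext_semiE //.
rewrite in_set oE; case vA: ((up v, ord_max) \in A); rewrite ?orbF ?andbT // andbF.
apply/esym/negP=> vS; have := out1 (up v); rewrite /out_deg vS addn1 ltnS leqn0 cards_eq0.
by move/eqP/setP/(_ ord_max); rewrite !inE vA.
Qed.

(* For the upper and for the lower side: the semi-arc closed at the new vertex, if
   any, and whether a semi-arc starts there. *)
Definition move n : Type := (option 'I_n * bool) * (option 'I_n * bool).

Definition ext n (d : prediagram n) (m : move n) : prediagram n.+1 :=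
  Prediagram (ext_arcs (upper_arcs d) m.1.1) (ext_semi (upper_semi d) m.1.1 m.1.2)
             (ext_arcs (lower_arcs d) m.2.1) (ext_semi (lower_semi d) m.2.1 m.2.2).

Definition res n (d : prediagram n.+1) : prediagram n :=
  Prediagram (res_arcs (upper_arcs d)) (res_semi (upper_arcs d) (upper_semi d))
             (res_arcs (lower_arcs d)) (res_semi (lower_arcs d) (lower_semi d)).

Definition vertex_types : seq (nat * nat * nat * nat) :=
  [:: (0, 0, 0, 0); (0, 1, 0, 1); (1, 0, 1, 0); (1, 1, 0, 0); (0, 0, 1, 1)].

Lemma open_diagramE n (d : prediagram n) :
  open_diagram d =
  [&& [forall p in upper_arcs d, p.1 < p.2], [forall p in lower_arcs d, p.1 < p.2]
    & [forall v, degrees d v \in vertex_types]].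
Proof.
by rewrite /open_diagram; do 2!congr (_ && _); apply: eq_forallb => v; rewrite !inE.
Qed.

Definition valid_move n (d : prediagram n) (m : move n) :=
  [&& m.1.1 \isub upper_semi d, m.2.1 \isub lower_semi d &
      (nat_of_bool m.1.1, nat_of_bool m.1.2, nat_of_bool m.2.1, nat_of_bool m.2.2)
        \in vertex_types].

Section ValidMove.

Variables (n : nat) (d : prediagram n) (m : move n).
Hypothesis md : valid_move d m.

Lemma degrees_ext_up v : degrees (ext d m) (up v) = degrees d v.
Proof.
case/and3P: md => uS lS _.
by rewrite /degrees /= !in_deg_ext_up !out_deg_ext_up.
Qed.

Lemma degrees_ext_max : degrees (ext d m) ord_max =
  (nat_of_bool m.1.1, nat_of_bool m.1.2, nat_of_bool m.2.1, nat_of_bool m.2.2).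
Proof. by rewrite /degrees /= !in_deg_ext_max !out_deg_ext_max. Qed.

Lemma resK : res (ext d m) = d.
Proof.
case/and3P: md => uS lS _.
by rewrite /res /= !ext_arcsK !ext_semiK //; case: (d).
Qed.

Lemma open_ext : open_diagram (ext d m) = open_diagram d.
Proof.
rewrite !open_diagramE !ltn_ext_arcs; do 2!congr (_ && _).
apply/forallP/forallP=> H v; first by rewrite -degrees_ext_up.
case: (max_or_upP v) => [|i]; last by rewrite degrees_ext_up.
by rewrite degrees_ext_max; case/and3P: md.
Qed.

Lemma fixed_points_ext : fixed_points (ext d m) =
  ext_set (fixed_points d) [&& ~~ m.1.1, ~~ m.1.2, ~~ m.2.1 & ~~ m.2.2].
Proof.
apply/setP=> v; rewrite in_set /fixed_point.
case: (max_or_upP v) => [|i]; last by rewrite ext_setE degrees_ext_up in_set.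
by rewrite ext_setE degrees_ext_max; case: (m) => [[[x|] []] [[y|] []]].
Qed.

Lemma nonnesting_ext : nonnesting 3 (ext d m) =
  [&& nonnesting 3 d,
      (if m.1.1 is Some x then
         closable (upper_arcs d) (upper_semi d) (fixed_points d) x else true) &
      (if m.2.1 is Some x then
         closable (lower_arcs d) (lower_semi d) set0 x else true)].
Proof.
case/and3P: md => uS lS _.
(* The empty set of fixed points on the lower side is written as an extension of [set0], so that one
   lemma treats both sides. *)
rewrite !nonnestingE fixed_points_ext /= -(ext_set0 n) !half_nonnesting_ext //.
by rewrite andbACA.
Qed.

End ValidMove.

Lemma ext_surj n (e : prediagram n.+1) :
  open_diagram e -> exists2 m, valid_move (res e) m & e = ext (res e) m.
Proof.
rewrite open_diagramE => /and3P[lt_u lt_l /forallP dege].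
have deg1 v : [&& in_deg (upper_arcs e) v <= 1, out_deg (upper_arcs e) (upper_semi e) v <= 1,
    in_deg (lower_arcs e) v <= 1 & out_deg (lower_arcs e) (lower_semi e) v <= 1].
  move: (dege v); rewrite /degrees.
  by case: in_deg => [|[|?]]; case: out_deg => [|[|?]];
     case: in_deg => [|[|?]]; case: out_deg => [|[|?]].
have [||ou [ouS uA uS]] := ext_res lt_u (S := upper_semi e).
- by case/and4P: (deg1 ord_max).
- by move=> v; case/and4P: (deg1 v).
have [||ol [olS lA lS]] := ext_res lt_l (S := lower_semi e).
- by case/and4P: (deg1 ord_max).
- by move=> v; case/and4P: (deg1 v).
pose m : move n := ((ou, ord_max \in upper_semi e), (ol, ord_max \in lower_semi e)).
have eE : e = ext (res e) m by rewrite /ext /= uA uS lA lS; case: (e).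
exists m => //; rewrite /valid_move ouS olS /=.
(* Once [e] is seen as an extension, the degrees of its last vertex are the quadruple in
   [valid_move]. *)
by have := dege ord_max; rewrite {1}eE degrees_ext_max.
Qed.

(** Induction by deleting the last vertex: an opener adds one semi-arc on each side, a closer
    removes one from each, and the other types keep both numbers. *)
Lemma card_semi_eq n (d : prediagram n) :
  open_diagram d -> #|upper_semi d| = #|lower_semi d|.
Proof.
elim: n d => [|n IHn] d dO.
  have S0 (S : {set 'I_0}) : #|S| = 0 by apply: eq_card0 => [[]].
  by rewrite !S0.
have [m mv dE] := ext_surj dO; case/and3P: (mv) => uS lS mt.
move: dO; rewrite dE open_ext // => /IHn eqS.
have := card_ext_semi m.1.2 uS; have := card_ext_semi m.2.2 lS.
rewrite -eqS /=; case: m mt {mv dE uS lS} => [[[x|] []] [[y|] []]] //= _;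
  rewrite ?addn0 ?addn1;
  first [by move=> -> -> | by move=> <- [->] | by move=> -> [->] | by move=> [->] ->].
Qed.

(** * Children of a 3-nonnesting diagram *)

(** Listed in the order of the succession rule: fixed point, opener, upper transitory, lower
    transitory, closer. *)
Definition moves n (d : prediagram n) : seq (move n) :=
  let U := closable_semis (upper_arcs d) (upper_semi d) (fixed_points d) in
  let L := closable_semis (lower_arcs d) (lower_semi d) set0 in
  [:: ((None, false), (None, false)); ((None, true), (None, true))]
  ++ [seq ((Some x, true), (None, false)) | x <- U]
  ++ [seq ((None, false), (Some y, true)) | y <- L]
  ++ [seq ((Some x, false), (Some y, false)) | x <- U, y <- L].

Lemma mem_closable_semis n (A : {set 'I_n * 'I_n}) (S F : {set 'I_n}) x :
  (x \in closable_semis A S F) = (x \in S) && closable A S F x.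
Proof. by rewrite mem_filter mem_enum andbC. Qed.

Lemma uniq_closable_semis n (A : {set 'I_n * 'I_n}) (S F : {set 'I_n}) :
  uniq (closable_semis A S F).
Proof. by rewrite filter_uniq ?enum_uniq. Qed.

Lemma mem_moves n (d : prediagram n) m : (m \in moves d) =
  [&& valid_move d m,
      ((if m.1.1 is Some x then
         closable (upper_arcs d) (upper_semi d) (fixed_points d) x else true) : bool) &
      ((if m.2.1 is Some x then
         closable (lower_arcs d) (lower_semi d) set0 x else true) : bool)].
Proof.
apply/idP/idP.
  rewrite /moves !mem_cat => /or4P[].
  - by rewrite !inE => /orP[] /eqP->.
  - by case/mapP=> x; rewrite mem_closable_semis => /andP[xS xc] ->; rewrite /valid_move /= xS xc.
  - by case/mapP=> y; rewrite mem_closable_semis => /andP[yS yc] ->; rewrite /valid_move /= yS yc.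
  case/allpairsP=> [[x y]] /= [].
  rewrite !mem_closable_semis => /andP[xS xc] /andP[yS yc] ->.
  by rewrite /valid_move /= xS yS xc.
case/and3P=> /and3P[]; rewrite /moves !mem_cat.
case: m => [[[x|] []] [[y|] []]] // xS yS _ xc yc; rewrite /= in xS yS xc yc.
- apply/or4P/Or42/map_f; by rewrite mem_closable_semis xS.
- by apply/or4P/Or44/allpairs_f; rewrite mem_closable_semis ?xS ?yS.
- by apply/or4P/Or43/map_f; rewrite mem_closable_semis yS.
Qed.

Lemma uniq_moves n (d : prediagram n) : uniq (moves d).
Proof.
rewrite /moves; set U := closable_semis _ _ _; set L := closable_semis _ _ _.
have [uU uL] : uniq U /\ uniq L by split; apply: uniq_closable_semis.
rewrite !cat_uniq !map_inj_uniq //; try by move=> ? ? [].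
rewrite uU uL allpairs_uniq //=; last by move=> [? ?] [? ?] _ _ [-> ->].
rewrite !has_cat !negb_or !andbT /=; do ?[apply/andP; split]; apply/hasPn=> m.
all: try by case/mapP=> ? _ ->; rewrite !inE; apply/norP; split.
all: try by case/allpairsP=> ? [_ _ ->]; rewrite !inE.
- by case/mapP=> ? _ ->; apply/mapP=> [[]].
- by case/allpairsP=> ? [_ _ ->]; apply/mapP=> [[]].
- by case/allpairsP=> ? [_ _ ->]; apply/mapP=> [[]].
Qed.

(** The arc ending at the last vertex reveals the closed semi-arc, and a semi-arc there reveals the
    flag. *)
Lemma ext_inj n (d : prediagram n) : injective (ext d).
Proof.
move=> [[ou bu] [ol bl]] [[ou' bu'] [ol' bl']] [uA uS lA lS].
have arcs_inj (A : {set 'I_n * 'I_n}) o o' : ext_arcs A o = ext_arcs A o' -> o = o'.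
  case: o o' => [x|] [y|] //= eqA.
  - have := (ext_arcsE A (Some y)).1.2 x; rewrite -eqA ext_arcsE eqxx.
    by move/esym/eqP.
  - by have := (ext_arcsE A None).1.2 x; rewrite -eqA ext_arcsE eqxx.
  - by have := (ext_arcsE A None).1.2 y; rewrite eqA ext_arcsE eqxx.
have semi_inj (S : {set 'I_n}) o o' b b' : ext_semi S o b = ext_semi S o' b' -> b = b'.
  by move/setP/(_ ord_max); rewrite !ext_semiE.
by rewrite (arcs_inj _ _ _ uA) (arcs_inj _ _ _ lA) (semi_inj _ _ _ _ _ uS) (semi_inj _ _ _ _ _ lS).
Qed.

Lemma mem_Sigma2_ext n (d : prediagram n) m :
  valid_move d m -> (ext d m \in Sigma2 n.+1) = (d \in Sigma2 n) && (m \in moves d).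
Proof.
by move=> mv; rewrite mem_moves mv !inE open_ext // nonnesting_ext //= !andbA.
Qed.

(** Each diagram has a unique parent, given by [res], and a unique move from it. No parent is lost,
    since an extension is 3-nonnesting only if its parent is. *)
Lemma perm_Sigma2 n :
  perm_eq (enum (Sigma2 n.+1)) [seq ext d m | d <- enum (Sigma2 n), m <- moves d].
Proof.
apply: uniq_perm; first exact: enum_uniq.
  apply: allpairs_uniq_dep; rewrite ?enum_uniq //.
    by move=> d _; apply: uniq_moves.
  move=> _ _ /allpairsPdep[d [m [_ mM ->]]] /allpairsPdep[d' [m' [_ mM' ->]]] /= eq_ext.
  move: mM mM'; rewrite /= !mem_moves => /and3P[mv _ _] /and3P[mv' _ _].
  have dd' : d = d' by rewrite -(resK mv) -(resK mv') eq_ext.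
  by case: _ / dd' in m' eq_ext mv' *; rewrite (ext_inj eq_ext).
move=> e; rewrite mem_enum; apply/idP/allpairsPdep.
  move=> eS; have := eS; rewrite inE => /andP[/ext_surj[m mv eE] _].
  move: eS; rewrite eE mem_Sigma2_ext // => /andP[dS mM].
  by exists (res e), m; rewrite mem_enum.
case=> d [m [dS mM ->]]; rewrite mem_enum in dS.
have := mM; rewrite mem_moves => /andP[mv _].
by rewrite mem_Sigma2_ext // dS.
Qed.

Lemma open_diagram_label n (d : prediagram n) : open_diagram d ->
  diagram_label d =
  (#|upper_semi d|,
   #|covering (upper_arcs d) (upper_semi d) (fixed_points d)|,
   #|covering (lower_arcs d) (lower_semi d) set0|).
Proof. by move=> dO; rewrite diagram_labelE -card_semi_eq // addnn doubleK. Qed.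

(** A new fixed point lies to the right of all old semi-arcs and puts each of them in a future
    2-nesting. *)
Lemma card_covering_ext_none n (A : {set 'I_n * 'I_n}) (S F : {set 'I_n}) b f :
  #|covering (ext_arcs A None) (ext_semi S None b) (ext_set F f)| =
  if f then #|S| else #|covering A S F|.
Proof.
rewrite card_covering_ext; case: f; apply: eq_card => a; rewrite !inE /=.
  by rewrite orbT andbT.
by rewrite orbF.
Qed.

Lemma eq_perm (T : eqType) (s t : seq T) : s = t -> perm_eq s t.
Proof. by move->. Qed.

Lemma perm_ext_label n (d : prediagram n) : open_diagram d ->
  perm_eq [seq diagram_label (ext d m) | m <- moves d] (succession (diagram_label d)).
Proof.
move=> dO; rewrite (open_diagram_label dO).
set U := closable_semis (upper_arcs d) (upper_semi d) (fixed_points d).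
set L := closable_semis (lower_arcs d) (lower_semi d) set0.
set h := #|upper_semi d|; set r := #|covering _ _ _|; set s := #|covering _ _ _|.
pose fU b x := #|covering (ext_arcs (upper_arcs d) (Some x))
  (ext_semi (upper_semi d) (Some x) b) (ext_set (fixed_points d) false)|.
pose fL b y := #|covering (ext_arcs (lower_arcs d) (Some y))
  (ext_semi (lower_semi d) (Some y) b) (ext_set set0 false)|.
have pU b : perm_eq [seq fU b x | x <- U] (index_iota r.-1 h) := perm_closable _ _ _ b.
have pL b : perm_eq [seq fL b y | y <- L] (index_iota s.-1 h).
  by rewrite /h card_semi_eq //; apply: perm_closable.
have labelE m : valid_move d m -> diagram_label (ext d m) =
    (#|ext_semi (upper_semi d) m.1.1 m.1.2|,
     #|covering (ext_arcs (upper_arcs d) m.1.1) (ext_semi (upper_semi d) m.1.1 m.1.2)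
       (ext_set (fixed_points d) [&& ~~ m.1.1, ~~ m.1.2, ~~ m.2.1 & ~~ m.2.2])|,
     #|covering (ext_arcs (lower_arcs d) m.2.1) (ext_semi (lower_semi d) m.2.1 m.2.2)
       (ext_set set0 false)|).
  by move=> mv; rewrite open_diagram_label ?open_ext // fixed_points_ext //= ext_set0.
have semi_None b : #|ext_semi (upper_semi d) None b| = h + b.
  by rewrite -(card_ext_semi (o := None) b isT) addn0.
(* The semi-arc [x] is counted in [h], so the predecessor is never taken at 0. *)
have semi_Some b x : x \in U -> #|ext_semi (upper_semi d) (Some x) b| = (h + b).-1.
  rewrite mem_closable_semis => /andP[xS _].
  by rewrite -(card_ext_semi (o := Some x) b xS) addn1.
rewrite /moves !map_cat -/U -/L /succession.
(* The four goals concern fixed point and opener together, upper transitory, lower transitory, and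
   closer. *)
apply: perm_cat; last apply: perm_cat; last apply: perm_cat.
- rewrite /= !labelE //= !semi_None !card_covering_ext_none.
  by rewrite addn0 addn1.
- rewrite -map_comp; apply: perm_trans (perm_map (fun i => (h, i, s)) (pU true)).
  rewrite -map_comp; apply/eq_perm/eq_in_map => x xU /=.
  rewrite labelE /=; last first.
    by move: xU; rewrite mem_closable_semis /valid_move /= => /andP[->].
  by rewrite semi_Some // addn1 card_covering_ext_none.
- rewrite -map_comp; apply: perm_trans (perm_map (fun j => (h, r, j)) (pL true)).
  rewrite -map_comp; apply/eq_perm/eq_in_map => y yL /=.
  rewrite labelE /=; last first.
    by move: yL; rewrite mem_closable_semis /valid_move /= => /andP[->].
  by rewrite semi_None addn0 card_covering_ext_none.
apply: perm_trans (perm_allpairs (fun i j => (h.-1, i, j)) (pU false) (pL false)).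
rewrite allpairs_mapl allpairs_mapr map_allpairs.
apply/eq_perm/eq_in_allpairs => x y xU yL.
rewrite labelE /= ?semi_Some ?addn0 //.
move: xU yL; rewrite !mem_closable_semis /valid_move /=.
by move=> /andP[-> _] /andP[-> _].
Qed.

Lemma perm_tree_level n :
  perm_eq [seq diagram_label d | d <- enum (Sigma2 n)]
          (tree_level (0, 0, 0) succession n).
Proof.
elim: n => [|n IHn] /=.
  have I0 (S : {set 'I_0}) : #|S| = 0 by apply: eq_card0 => [[]].
  have P0 (S : {set 'I_0 * 'I_0}) : S = set0 by apply/setP=> [[[]]].
  have E0 (S : {set 'I_0}) : S = set0 by apply/setP=> [[]].
  (* At level 0 the empty diagram is the only one, and its label is that of the root. *)
  pose d0 : prediagram 0 := Prediagram set0 set0 set0 set0.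
  have dE d : d = d0 by case: d => ua us la ls; rewrite (P0 ua) (E0 us) (P0 la) (E0 ls).
  have d0S : d0 \in Sigma2 0.
    have nn A (S F : {set 'I_0}) : half_nonnesting A S F.
      by apply/andP; split; [apply/negP=> /nest_lt | apply/forallP=> [[]]].
    rewrite inE open_diagramE nonnestingE !nn !andbT.
    by apply/and3P; split; apply/forallP=> [[]] // [].
  have -> : enum (Sigma2 0) = [:: d0].
    apply/perm_small_eq => //; apply: uniq_perm => // [|d]; first exact: enum_uniq.
    by rewrite mem_enum mem_seq1 (dE d) eqxx.
  by rewrite /= diagram_labelE !I0.
apply: perm_trans (perm_map _ (perm_Sigma2 n)) _.
apply: perm_trans (perm_flatten (perm_map succession IHn)).
rewrite map_allpairs -map_comp.
have : {in enum (Sigma2 n), forall d, open_diagram d}.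
  by move=> d; rewrite mem_enum inE => /andP[].
(* The lists of children are compared parent by parent. *)
elim: (enum _) => [//|d ds IHds opn]; apply: (@perm_cat _ (map _ (moves d))).
  by apply: perm_ext_label; apply: opn; rewrite mem_head.
by apply: IHds => d' d'in; apply: opn; rewrite inE d'in orbT.
Qed.

(** * Permutations as diagrams without semi-arcs *)

Section PermDiagram.

Variables (n : nat) (s : 'S_n).

Lemma mem_upper_perm a b :
  ((a, b) \in upper_arcs (perm_diagram s)) = (s a == b) && (a < b).
Proof.
apply/imsetP/andP=> [[k + [-> ->]]|[/eqP<- ab]]; first by rewrite inE.
by exists a; rewrite ?inE.
Qed.

Lemma mem_lower_perm a b :
  ((a, b) \in lower_arcs (perm_diagram s)) = (s b == a) && (a < b).
Proof.
apply/imsetP/andP=> [[k + [-> ->]]|[/eqP<- ab]]; first by rewrite inE.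
by exists b; rewrite ?inE.
Qed.

(** The degrees at [v] are determined by comparing [v] with its image and its preimage. The four
    strict patterns are the non-fixed types, and equality holds in both comparisons or in
    neither. *)
Lemma open_perm_diagram : open_diagram (perm_diagram s).
Proof.
rewrite open_diagramE; apply/and3P; split.
- by apply/'forall_implyP=> [[a b]]; rewrite mem_upper_perm => /andP[].
- by apply/'forall_implyP=> [[a b]]; rewrite mem_lower_perm => /andP[].
apply/forallP=> v; rewrite /degrees /in_deg /out_deg !in_set0 !addn0.
have card1P (P : pred 'I_n) w (c : bool) :
    (forall a, P a = (a == w) && c) -> #|[set a | P a]| = c.
  move=> PE; rewrite (eq_card (B := if c then [set w] else set0)).
    by case: c {PE}; rewrite ?cards1 ?cards0.
  by move=> a; rewrite inE PE; case: c {PE}; rewrite !inE ?andbT ?andbF.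
pose w := (s^-1)%g v.
have sw a : (s a == v) = (a == w) by rewrite -[RHS](inj_eq (@perm_inj _ s)) permKV.
rewrite (card1P _ w (w < v)); last first.
  by move=> a; rewrite mem_upper_perm sw; case: eqP => // ->.
rewrite (card1P _ (s v) (v < s v)); last first.
  by move=> a; rewrite mem_upper_perm eq_sym; case: eqP => // ->.
rewrite (card1P _ (s v) (s v < v)); last first.
  by move=> a; rewrite mem_lower_perm eq_sym; case: eqP => // ->.
rewrite (card1P _ w (v < w)); last first.
  by move=> a; rewrite mem_lower_perm sw; case: eqP => // ->.
have : (w == v) = (s v == v) by rewrite eq_sym -sw.
by rewrite -!val_eqE /=; case: (ltngtP w v); case: (ltngtP (s v) v).
Qed.

End PermDiagram.

Lemma perm_diagram_inj n : injective (@perm_diagram n).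
Proof.
move=> s t eq_st; apply/permP=> i.
have memU (u : 'S_n) j := mem_upper_perm u i j.
have memL (u : 'S_n) j := mem_lower_perm u j i.
have [si|si|/val_inj si] := ltngtP i (s i).
- by have := memU s (s i); rewrite eq_st memU eqxx si andbT => /eqP.
- by have := memL s (s i); rewrite eq_st memL eqxx si andbT => /eqP.
have [ti|ti|/val_inj ti] := ltngtP i (t i); last by rewrite -si -ti.
- by have := memU t (t i); rewrite -eq_st memU eqxx ti andbT => /eqP.
- by have := memL t (t i); rewrite -eq_st memL eqxx ti andbT => /eqP.
Qed.

(** Reading upper arcs from left to right, lower arcs from right to left, and fixed points as loops,
    the vertex types say that exactly one edge leaves and one enters each vertex. *)
Lemma perm_diagram_surj n (d : prediagram n) :
  open_diagram d -> upper_semi d = set0 -> lower_semi d = set0 ->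
  exists s, d = perm_diagram s.
Proof.
rewrite open_diagramE => /and3P[/'forall_implyP lt_u /'forall_implyP lt_l /forallP deg_d].
move=> uS0 lS0.
set U := upper_arcs d in lt_u *; set L := lower_arcs d in lt_l *.
have deg v : (#|[set a | (a, v) \in U]|, #|[set b | (v, b) \in U]|,
    #|[set a | (a, v) \in L]|, #|[set b | (v, b) \in L]|) \in vertex_types.
  by have := deg_d v; rewrite /degrees /in_deg /out_deg uS0 lS0 !in_set0 !addn0.
have uniq1 (P : pred 'I_n) : #|[set a | P a]| <= 1 -> forall x y, P x -> P y -> x = y.
  by move/card_le1_eqP=> P1 x y Px Py; apply: P1; rewrite inE.
have pos (P : pred 'I_n) x : P x -> #|[set a | P a]| == 0 = false.
  by move=> Px; rewrite cards_eq0; apply/negP=> /eqP/setP/(_ x); rewrite !inE Px.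
(* A vertex never has both an incoming upper and an outgoing lower arc, nor the
   converse, and it is a fixed point as soon as it has neither an incoming lower
   nor an outgoing upper arc. *)
have degP v : [/\ #|[set a | (a, v) \in U]| <= 1, #|[set b | (v, b) \in U]| <= 1,
    #|[set a | (a, v) \in L]| <= 1 & #|[set b | (v, b) \in L]| <= 1]
  /\ [/\ (#|[set a | (a, v) \in U]| == 0) || (#|[set b | (v, b) \in L]| == 0),
         (#|[set a | (a, v) \in L]| == 0) || (#|[set b | (v, b) \in U]| == 0) &
         (#|[set a | (a, v) \in L]| == 0) && (#|[set b | (v, b) \in U]| == 0) ->
         (#|[set a | (a, v) \in U]| == 0) && (#|[set b | (v, b) \in L]| == 0)].
  move: (deg v); rewrite !inE.
  by case/or4P=> [||| /orP[]] /eqP[-> -> -> ->].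
have outU v x y : (v, x) \in U -> (v, y) \in U -> x = y.
  by apply: (uniq1 (fun b => (v, b) \in U)); have [[]] := degP v.
have inU v x y : (x, v) \in U -> (y, v) \in U -> x = y.
  by apply: (uniq1 (fun b => (b, v) \in U)); have [[]] := degP v.
have outL v x y : (v, x) \in L -> (v, y) \in L -> x = y.
  by apply: (uniq1 (fun b => (v, b) \in L)); have [[]] := degP v.
have inL v x y : (x, v) \in L -> (y, v) \in L -> x = y.
  by apply: (uniq1 (fun b => (b, v) \in L)); have [[]] := degP v.
have inU_outL v x y : (x, v) \in U -> (v, y) \in L -> False.
  move=> xU yL; have [_ [+ _ _]] := degP v.
  by rewrite (pos (fun a => (a, v) \in U) x) ?(pos (fun b => (v, b) \in L) y).
have inL_outU v x y : (x, v) \in L -> (v, y) \in U -> False.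
  move=> xL yU; have [_ [_ + _]] := degP v.
  by rewrite (pos (fun a => (a, v) \in L) x) ?(pos (fun b => (v, b) \in U) y).
(* The loop alternative excludes arcs of all four kinds at [v], which separates loops from arcs in
   the proof of injectivity. *)
pose image v w := [|| (v, w) \in U, (w, v) \in L |
  [&& v == w, [forall a, (a, v) \notin U] & [forall b, (v, b) \notin L]]
   && [forall a, (a, v) \notin L] && [forall b, (v, b) \notin U]].
have card0 (P : pred 'I_n) : #|[set a | P a]| == 0 = [forall a, ~~ P a].
  rewrite cards_eq0; apply/eqP/forallP=> [P0 a|nP].
    by apply/negP=> Pa; have := in_set0 a; rewrite -P0 inE Pa.
  by apply/setP=> a; rewrite !inE (negPf (nP a)).
have image_ex v : exists w, image v w.
  have [/existsP[w vw]|nU] := boolP [exists w, (v, w) \in U]; first by exists w; rewrite /image vw.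
  have [/existsP[w vw]|nL] := boolP [exists w, (w, v) \in L].
    by exists w; rewrite /image vw orbT.
  exists v; have [_ [_ _]] := degP v; rewrite !card0 /image eqxx /=.
  rewrite -!negb_exists nU nL => /(_ isT)/andP[-> ->].
  by rewrite !orbT.
have [f fP] := fin_all_exists image_ex.
(* Two arcs leading to [w] on the same side contradict a degree bound; on different sides they
   contradict [inU_outL]. *)
have f_inj : injective f.
  move=> x y eq_f; have := fP x; have := fP y; rewrite -eq_f; move: (f x) => w.
  rewrite /image.
  case/or3P=> [yU|yL|/andP[/andP[/and3P[/eqP-> /forallP nU /forallP nL]] _ _]];
  case/or3P=> [xU|xL|/andP[/andP[/and3P[/eqP-> /forallP mU /forallP mL]] _ _]] //.
  - exact: inU yU.
  - by case: (inU_outL w y x).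
  - by have := mU y; rewrite yU.
  - by case: (inU_outL w x y).
  - exact: outL yL.
  - by have := mL y; rewrite yL.
  - by have := nU x; rewrite xU.
  - by have := nL x; rewrite xL.
exists (perm f_inj).
have fU a b : (a, b) \in U = (f a == b) && (a < b).
  apply/idP/andP=> [abU|[/eqP<- lt_af]].
    split; last exact: lt_u abU.
    case/or3P: (fP a) => [aU|aL|]; [by rewrite (outU _ _ _ aU abU)|by case: (inL_outU a (f a) b)|].
    by case/andP=> _ /forallP/(_ b); rewrite abU.
  case/or3P: (fP a) => // [/lt_l /=|]; first by rewrite ltnNge ltnW.
  by case/andP=> /andP[/and3P[/eqP eq_a _ _] _ _]; rewrite -eq_a ltnn in lt_af.
have fL a b : (a, b) \in L = (f b == a) && (a < b).
  apply/idP/andP=> [abL|[/eqP<- lt_fb]].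
    split; last exact: lt_l abL.
    case/or3P: (fP b) => [bU|bL|]; [by case: (inL_outU b a (f b))|by rewrite (inL _ _ _ bL abL)|].
    by case/andP=> /andP[_ /forallP/(_ a)]; rewrite abL.
  case/or3P: (fP b) => // [/lt_u /=|]; first by rewrite ltnNge ltnW.
  by case/andP=> /andP[/and3P[/eqP eq_b _ _] _ _]; rewrite -eq_b ltnn in lt_fb.
have dE : d = Prediagram U set0 L set0 by rewrite /U /L; move: uS0 lS0; case: (d) => ? ? ? ? /= -> ->.
rewrite dE; congr Prediagram; apply/setP=> [[a b]].
  by rewrite fU mem_upper_perm permE.
by rewrite fL mem_lower_perm permE.
Qed.

(** The last two components count subsets of the semi-arcs, and both sides have equally many
    semi-arcs, so everything vanishes with the first component. *)
Lemma diagram_label_eq0 n (d : prediagram n) : open_diagram d ->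
  (diagram_label d == (0, 0, 0)) = (upper_semi d == set0) && (lower_semi d == set0).
Proof.
move=> dO; rewrite open_diagram_label // !xpair_eqE.
rewrite -[lower_semi d == _]cards_eq0 -card_semi_eq // cards_eq0 andbb.
have [u0|//] := eqVneq (upper_semi d) set0.
have /eqP l0 : lower_semi d == set0 by rewrite -cards_eq0 -card_semi_eq // u0 cards0.
have cov0 (A : {set 'I_n * 'I_n}) F : #|covering A set0 F| == 0.
  by rewrite cards_eq0 -subset0 covering_sub.
by rewrite u0 l0 !(eqP (cov0 _ _)).
Qed.

(** [perm_diagram] is a bijection onto the open diagrams without semi-arcs, which are those with
    label [(0, 0, 0)]. *)
Lemma card_perm_nonnesting n :
  #|[set s : 'S_n | nonnesting 3 (perm_diagram s)]| =
  #|[set d in Sigma2 n | diagram_label d == (0, 0, 0)]|.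
Proof.
rewrite -(card_imset _ (@perm_diagram_inj n)); apply: eq_card => d.
rewrite [RHS]in_set [d \in Sigma2 n]in_set; apply/imsetP/andP.
  case=> s; rewrite in_set => sN ->; rewrite open_perm_diagram sN; split=> //.
  by rewrite diagram_label_eq0 ?open_perm_diagram // !eqxx.
case=> /andP[dO dN]; rewrite diagram_label_eq0 // => /andP[/eqP u0 /eqP l0].
by have [s dE] := perm_diagram_surj dO u0 l0; exists s; rewrite ?in_set -?dE.
Qed.

Theorem theorem10 (n : nat) :
  #|Sigma2 n| = size (tree_level (0, 0, 0) succession n)
  /\
  #|[set s : 'S_n | nonnesting 3 (perm_diagram s)]|
    = count_mem (0, 0, 0) (tree_level (0, 0, 0) succession n).
Proof.
have pl := perm_tree_level n; split.
  by rewrite -(perm_size pl) size_map -cardE.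
rewrite card_perm_nonnesting -(seq.permP pl) count_map -size_filter cardE.
apply/perm_size/uniq_perm; first exact: enum_uniq.
  by apply: filter_uniq; apply: enum_uniq.
by move=> d; rewrite mem_enum [RHS]mem_filter mem_enum in_set andbC.
Qed.
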